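(* Let $G$ be a finite simple graph without isolated vertices, with minimum degree $\delta$ and maximum degree $\Delta$, and let $a \in \mathbb{R}$. Then $$ISD_a(G) \le \frac12\, \delta^{-a}\, AG(G), \qquad \text{if } a>0,$$ $$ISD_a(G) \le \frac12\, \Delta^{-a}\, AG(G), \qquad \text{if } a<0.$$ In each bound, equality is attained if and only if $G$ is a regular graph.
   Context: Graphs are undirected, finite, nonempty, simple (no loops, no multiple edges), without isolated vertices, and not necessarily connected; so $1\le\delta\le\Delta<n$ where $n=|V(G)|$. $d_u$ denotes the degree of the vertex $u$, and $uv$ denotes the (unordered) edge joining $u$ and $v$; sums over $uv\in E(G)$ run once over each edge. For $a\in\mathbb{R}$ the variable inverse sum deg index is $$ISD_a(G)=\sum_{uv\in E(G)}\frac{1}{d_u^a+d_v^a}.$$ The arithmetic-geometric index is $$AG(G)=\sum_{uv\in E(G)}\frac{d_u+d_v}{2\sqrt{d_ud_v}}.$$ A graph is regular if all its vertices have the same degree. *)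

(* Defs.v *)
From mathcomp Require Import all_boot all_order all_algebra.
From mathcomp Require Import reals exp.

Set Implicit Arguments.
Unset Strict Implicit.
Unset Printing Implicit Defensive.

Import Order.TTheory GRing.Theory Num.Theory.

Local Open Scope ring_scope.

(* Graphs are adjacency relations adj on a vertex finType T; the definitions
   are meant for adj symmetric and irreflexive. *)

Definition degree (T : finType) (adj : rel T) (u : T) : nat :=
  #|[set v | adj u v]|.

(* Unordered edges: the two-element sets {u, v} with u, v adjacent. *)
Definition edges (T : finType) (adj : rel T) : {set {set T}} :=
  [set [set p.1; p.2] | p : T * T & adj p.1 p.2].

(* The neutral element #|T| exceeds every degree, so on a nonempty T this is
   the minimum of the degrees. *)
Definition min_degree (T : finType) (adj : rel T) : nat :=
  \big[minn/#|T|]_(u : T) degree adj u.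

Definition max_degree (T : finType) (adj : rel T) : nat :=
  \max_(u : T) degree adj u.

Definition regular_graph (T : finType) (adj : rel T) : Prop :=
  forall u v : T, degree adj u = degree adj v.

(* For an edge E = {u, v} with u != v, a sum (product) indexed by w in E is
   the sum (product) of the two terms at u and v; see sum_edge, prod_edge. *)
Definition ISD (R : realType) (T : finType) (adj : rel T) (a : R) : R :=
  \sum_(E in edges adj) 1 / (\sum_(w in E) (degree adj w)%:R `^ a).

Definition AG (R : realType) (T : finType) (adj : rel T) : R :=
  \sum_(E in edges adj)
    (\sum_(w in E) (degree adj w)%:R) /
    (2 * Num.sqrt (\prod_(w in E) (degree adj w)%:R)).

Lemma sum_edge (R : realType) (T : finType) (f : T -> R) (u v : T) :
  u != v -> \sum_(w in [set u; v]) f w = f u + f v.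
Proof. by move=> uv; rewrite big_setU1 ?big_set1 // inE. Qed.

Lemma prod_edge (R : realType) (T : finType) (f : T -> R) (u v : T) :
  u != v -> \prod_(w in [set u; v]) f w = f u * f v.
Proof. by move=> uv; rewrite big_setU1 ?big_set1 // inE. Qed.

(* Main.v *)
Require Import Defs.
From mathcomp Require Import all_boot all_order all_algebra.
From mathcomp Require Import reals exp.
From mathcomp Require Import ring.

Import Order.TTheory GRing.Theory Num.Theory.

Local Open Scope ring_scope.

(** Let [m] be the minimum degree if [a > 0] and the maximum degree if
    [a < 0]. Monotonicity of the power function gives [m `^ a <= d `^ a] for
    every degree [d], in both cases. Hence for an edge whose ends have degrees
    [x] and [y],
    [1 / (x `^ a + y `^ a) <= (1/2) m `^ (- a)
                           <= (1/2) m `^ (- a) * ((x + y) / (2 sqrt (x y)))],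
    the second step being the arithmetic-geometric mean inequality
    ([leif_AG_ratio]), and summing over the edges gives both bounds at once
    ([ISD_AG_leif]).

    For the equality case the inequalities are carried as [_ <= _ ?= iff _]:
    the first step is tight exactly when [x = y = m], since [`^ a] is injective
    on nonnegative reals for [a != 0], and then the second one is tight too. A
    sum of such inequalities is tight exactly when each of them is, that is,
    when all ends of edges have degree [m]. Without isolated vertices this
    means that every vertex has degree [m], which is regularity because [m] is
    itself the degree of some vertex. *)

Lemma leif_pV (R : numFieldType) (x y : R) (C : bool) :
  0 < x -> x <= y ?= iff C -> y^-1 <= x^-1 ?= iff C.
Proof.
move=> x_gt0 [le_xy eq_xy].
have y_gt0 : 0 < y by apply: lt_le_trans le_xy.
split; first by rewrite lef_pV2.
by rewrite (inj_eq invr_inj) eq_sym.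
Qed.

Lemma leif_sqrt_AGM (R : rcfType) (x y : R) :
  0 <= x -> 0 <= y -> Num.sqrt (x * y) <= (x + y) / 2 ?= iff (x == y).
Proof.
move=> x_ge0 y_ge0.
have [leAGM eqAGM] := leif_AGM2 x y.
have mean_ge0 : 0 <= (x + y) / 2 by rewrite divr_ge0 ?addr_ge0.
rewrite -[(x + y) / 2]ger0_norm // -sqrtr_sqr; split.
  by rewrite ler_sqrt ?sqr_ge0.
by rewrite eqr_sqrt ?sqr_ge0 ?mulr_ge0.
Qed.

Lemma leif_AG_ratio (R : rcfType) (x y : R) :
  0 < x -> 0 < y ->
  1 <= (x + y) / (2 * Num.sqrt (x * y)) ?= iff (x == y).
Proof.
move=> x_gt0 y_gt0.
have [le_s eq_s] := leif_sqrt_AGM _ _ _ (ltW x_gt0) (ltW y_gt0).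
have s_gt0 : 0 < Num.sqrt (x * y) by rewrite sqrtr_gt0 mulr_gt0.
have -> : (x + y) / (2 * Num.sqrt (x * y)) = (x + y) / 2 / Num.sqrt (x * y).
  by rewrite invfM mulrA.
split; first by rewrite ler_pdivlMr // mul1r.
by rewrite -eq_s -(inj_eq (mulIf (lt0r_neq0 s_gt0))) mul1r divfK ?lt0r_neq0.
Qed.

(** The case [a < 0] is reduced to the positive exponent [- a] by [powRN]. *)
Lemma powR_nneg_inj (R : realType) (a : R) :
  a != 0 -> {in Num.nneg &, injective (fun x : R => x `^ a)}.
Proof.
case/lt_total/orP => [a_lt0 | a_gt0]; last exact: powR_injective.
move=> x y x_ge0 y_ge0 eq_xy.
apply: (@powR_injective _ (- a)); rewrite ?oppr_gt0 //.
by rewrite !powRN eq_xy.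
Qed.

Lemma le0_ger_powR (R : realType) (a x y : R) :
  a <= 0 -> 0 < x -> x <= y -> y `^ a <= x `^ a.
Proof.
move=> a_le0 x_gt0 le_xy.
have y_gt0 : 0 < y by apply: lt_le_trans le_xy.
rewrite -lef_pV2 ?posrE ?powR_gt0 // -!powRN.
by apply: ge0_ler_powR; rewrite ?oppr_ge0 // nnegrE ltW.
Qed.

(** The bound for a single edge, with [x] and [y] the degrees of its ends and
    [m] the extremal degree. Bounding both powers below by [m `^ a] costs
    equality unless [x = y = m]; the arithmetic-geometric factor costs it unless
    [x = y], which that condition already implies. *)
Lemma leif_edge (R : realType) (a m x y : R) :
  a != 0 -> 0 < m -> 0 < x -> 0 < y ->
  m `^ a <= x `^ a -> m `^ a <= y `^ a ->
  1 / (x `^ a + y `^ a)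
    <= 1 / 2 * m `^ (- a) * ((x + y) / (2 * Num.sqrt (x * y)))
    ?= iff (x == m) && (y == m).
Proof.
move=> a_neq0 m_gt0 x_gt0 y_gt0 le_mx le_my.
have p_gt0 : 0 < m `^ a by apply: powR_gt0.
have eq_pow z : 0 < z -> (m `^ a == z `^ a) = (z == m).
  move=> z_gt0; rewrite eq_sym; apply/eqP/eqP => [|-> //].
  by apply: powR_nneg_inj; rewrite // nnegrE ltW.
have half_step : 1 / (x `^ a + y `^ a) <= 1 / 2 * m `^ (- a)
    ?= iff (x == m) && (y == m).
  have -> : 1 / 2 * m `^ (- a) = (m `^ a + m `^ a)^-1.
    by rewrite powRN; field; rewrite !gt_eqF ?addr_gt0.
  rewrite div1r -(eq_pow x) // -(eq_pow y) //.
  by apply: leif_pV; [rewrite addr_gt0 | apply: leifD; split].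
have AG_step : 1 / 2 * m `^ (- a)
    <= 1 / 2 * m `^ (- a) * ((x + y) / (2 * Num.sqrt (x * y))) ?= iff (x == y).
  have c_gt0 : 0 < 1 / 2 * m `^ (- a) by rewrite mulr_gt0 ?powR_gt0 ?divr_gt0.
  have [le_ratio eq_ratio] := leif_AG_ratio _ _ _ x_gt0 y_gt0.
  split; first by rewrite ler_peMr // ltW.
  by rewrite -eq_ratio -{1}[1 / 2 * _]mulr1 (inj_eq (mulfI (lt0r_neq0 c_gt0))).
have := leif_trans half_step AG_step.
(* The condition obtained, [x = y = m] and [x = y], collapses to the former. *)
by have [->|_] := eqVneq x m; have [->|_] := eqVneq y m; rewrite ?eqxx.
Qed.

Section Degrees.

Variables (T : finType) (adj : rel T).

Lemma degree_gt0 (u v : T) : adj u v -> (0 < degree adj u)%N.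
Proof. by move=> uv; apply/card_gt0P; exists v; rewrite inE. Qed.

Lemma max_degree_ge (u : T) : (degree adj u <= max_degree adj)%N.
Proof. exact: leq_bigmax. Qed.

Lemma min_degree_le (u : T) : (min_degree adj <= degree adj u)%N.
Proof. exact: (bigmin_le (T := nat)). Qed.

Lemma max_degree_attained :
  (0 < #|T|)%N -> exists u, degree adj u = max_degree adj.
Proof. by move=> /(bigop.eq_bigmax (degree adj))[u maxu]; exists u. Qed.

Lemma min_degree_attained :
  (0 < #|T|)%N -> exists u, degree adj u = min_degree adj.
Proof.
move=> /card_gt0P[u0 _].
have [u _ minu] : {u : T | u \in xpredT & min_degree adj = degree adj u}.
  (* The neutral element [#|T|] is not smaller than any degree, so it cannot
     be the minimum without being attained. *)
  by apply: (eq_bigmin (T := nat) u0) => // u _; apply: max_card.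
by exists u.
Qed.

(** The tightness condition of the summed inequality speaks of ends of edges.
    Every vertex is such an end, so it forces all degrees to equal [m];
    conversely, regularity forces the common degree to be [m] because [m] is
    attained. *)
Lemma forall_edges_degree (m : nat) :
  (forall u : T, exists v : T, adj u v) ->
  (exists u : T, degree adj u = m) ->
  [forall (E | E \in edges adj), [forall (w | w \in E), degree adj w == m]]
    <-> regular_graph adj.
Proof.
move=> no_isolated [u0 deg_u0].
split=> [all_m | reg]; last first.
  apply/forall_inP => E _; apply/forall_inP => w _.
  by rewrite -deg_u0 (reg w u0).
have deg_m u : degree adj u = m.
  have [v uv] := no_isolated u; apply/eqP.
  have uvE : [set u; v] \in edges adj.
    by apply/imsetP; exists (u, v); rewrite ?inE.
  by move/forall_inP/(_ _ uvE)/forall_inP: all_m; apply; rewrite set21.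
by move=> u v; rewrite !deg_m.
Qed.

(** The common form of both bounds: the minimum degree for [a > 0] and the
    maximum degree for [a < 0] enter only as a positive [m] whose power
    [m `^ a] is below that of every degree. *)
Lemma ISD_AG_leif (R : realType) (a : R) (m : nat) :
  symmetric adj -> irreflexive adj ->
  a != 0 -> (0 < m)%N ->
  (forall u, m%:R `^ a <= (degree adj u)%:R `^ a :> R) ->
  ISD adj a <= 1 / 2 * m%:R `^ (- a) * AG R adj
    ?= iff [forall (E | E \in edges adj),
             [forall (w | w \in E), degree adj w == m]].
Proof.
move=> adj_sym adj_irr a_neq0 m_gt0 le_m.
rewrite /ISD /AG mulr_sumr; apply: leif_sum => E /imsetP[[u v]].
rewrite inE /= => uv ->{E}.
have u_neq_v : u != v by apply: contraTneq uv => ->; rewrite adj_irr.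
have u_gt0 := degree_gt0 _ _ uv.
have v_gt0 : (0 < degree adj v)%N by apply: (degree_gt0 v u); rewrite adj_sym.
rewrite !sum_edge // prod_edge //.
have -> : [forall (w | w \in [set u; v]), degree adj w == m]
        = ((degree adj u)%:R == m%:R :> R) && ((degree adj v)%:R == m%:R :> R).
  rewrite !eqr_nat; apply/forall_inP/andP => [all_m | [um vm] w].
    by split; apply: all_m; rewrite ?set21 ?set22.
  by case/set2P => ->.
by apply: leif_edge; rewrite ?ltr0n.
Qed.

End Degrees.

Theorem theorem5 (R : realType) (T : finType) (adj : rel T)
    (T_nonempty : (0 < #|T|)%N)
    (adj_sym : symmetric adj)
    (adj_irr : irreflexive adj)
    (no_isolated : forall u : T, exists v : T, adj u v)
    (a : R) :
  (0 < a ->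
     let bound := 1 / 2 * (min_degree adj)%:R `^ (- a) * AG R adj in
     ISD adj a <= bound /\ (ISD adj a = bound <-> regular_graph adj)) /\
  (a < 0 ->
     let bound := 1 / 2 * (max_degree adj)%:R `^ (- a) * AG R adj in
     ISD adj a <= bound /\ (ISD adj a = bound <-> regular_graph adj)).
Proof.
have deg_gt0 u : (0 < degree adj u)%N.
  by have [v] := no_isolated u; apply: degree_gt0.
have bound_of m : a != 0 -> (exists u, degree adj u = m) ->
    (forall u, m%:R `^ a <= (degree adj u)%:R `^ a :> R) ->
    let bound := 1 / 2 * m%:R `^ (- a) * AG R adj in
    ISD adj a <= bound /\ (ISD adj a = bound <-> regular_graph adj).
  move=> a_neq0 m_deg le_m bound.
  have m_gt0 : (0 < m)%N by case: m_deg => u <-.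
  have [le_bound eq_bound] :=
    ISD_AG_leif _ _ _ _ _ adj_sym adj_irr a_neq0 m_gt0 le_m.
  split=> //; rewrite -(forall_edges_degree _ _ _ no_isolated m_deg) -eq_bound.
  by split=> /eqP.
split=> [a_gt0 | a_lt0]; apply: bound_of.
- by rewrite gt_eqF.
- exact: min_degree_attained.
- move=> u; apply: ge0_ler_powR; rewrite ?nnegrE ?ler0n ?(ltW a_gt0) //.
  by rewrite ler_nat min_degree_le.
- by rewrite lt_eqF.
- exact: max_degree_attained.
- move=> u; apply: le0_ger_powR; rewrite ?(ltW a_lt0) ?ltr0n //.
  by rewrite ler_nat max_degree_ge.
Qed.
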